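(* Let $K_a$ and $K_b$ be two virtual knots, and let $K_a\# K_b$ denote any connected sum of $K_a$ and $K_b$, with an arbitrary choice of the place where the connection is made. Then the odd writhe polynomials satisfy $$f_{K_a\# K_b}(t)=f_{K_a}(t)+f_{K_b}(t).$$
   Context: All virtual knot diagrams are oriented. A virtual knot diagram is a planar 4-valent graph (the image of one immersed oriented closed curve) in which each vertex is either a real crossing (with over/under information) or a virtual crossing. A virtual knot is an equivalence class of such diagrams under generalized Reidemeister moves: the classical moves $\Omega_1,\Omega_2,\Omega_3$ (on real crossings), their virtual versions $\Omega_1',\Omega_2',\Omega_3'$ (all crossings virtual), and the semivirtual third move $\Omega_3^s$ (a strand with two consecutive virtual crossings passes across a real crossing). The Gauss diagram of a diagram $D$ is an anticlockwise oriented circle with one chord for each real crossing, joining the two preimages of the crossing. Each chord is oriented from the preimage of the overcrossing to the preimage of the undercrossing and carries the sign $w(c)\in\{+1,-1\}$ equal to the writhe of the crossing. Crossings and chords are denoted by the same letter $c$. The over-endpoint of $c$ is $c^+$ and the under-endpoint is $c^-$. A Gauss diagram determines its virtual knot uniquely. A chord $c$ (and the real crossing $c$) is odd if the number of endpoints of other chords lying on one (equivalently, on each) of the two open arcs of the circle bounded by $c^+$ and $c^-$ is odd; otherwise it is even. $Odd(D)$ is the set of odd crossings. If $D$ has $n$ real crossings, the $2n$ chord endpoints divide the circle into $2n$ arcs. For an arc $a$, choose a point in $a$ and travel once along the circle in its orientation; $N(a)$ is the sum of $w(c)$ over all chords $c$ for which $c^+$ is met before $c^-$. For a chord $c$ define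 $N(c)\in\mathbb{Z}$ as follows: if $w(c)=+1$, $N(c)=N(\text{arc immediately after }c^-)-N(\text{arc immediately after }c^+)$; if $w(c)=-1$, $N(c)=N(\text{arc immediately before }c^-)-N(\text{arc immediately before }c^+)$, where before/after refer to the orientation of the circle. The odd writhe polynomial of a virtual knot $K$ is $f_K(t)=\sum_{c\in Odd(D)}w(c)\,t^{N(c)}\in\mathbb{Z}[t,t^{-1}]$ for any diagram $D$ of $K$ (equal to $0$ if there are no odd crossings); it does not depend on the choice of $D$. Connected sum: choose diagrams $D_a$ of $K_a$ and $D_b$ of $K_b$ and a non-crossing point on each, cut both diagrams at these points and join them compatibly with the orientations into one oriented diagram. On Gauss diagrams: cut the two oriented circles at points interior to arbitrarily chosen arcs and glue the two resulting oriented intervals end to end into a single oriented circle, keeping all chords with their directions and signs. For virtual knots the result depends in general on the choices of diagrams and points; $K_a\#K_b$ denotes any virtual knot obtained in this way. *)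

(* Defs.v *)
From Stdlib Require Import Relation_Operators.
From mathcomp Require Import all_boot all_order all_algebra.
From mathcomp Require Import generic_quotient fraction boolp.

Set Implicit Arguments.
Unset Strict Implicit.
Unset Printing Implicit Defensive.

Import GRing.Theory.
Local Open Scope ring_scope.

(* A virtual knot diagram is recorded by the cyclic word of the passages of the
   curve through its crossings, real and virtual.  A passage is a triple
   (x, f, r):
   - x names the crossing;
   - f is true iff rotating the tangent of this passage anticlockwise (by less
     than a half-turn) gives the tangent of the other passage through x;
   - r is Some true (over) or Some false (under) if x is real, None if x is
     virtual.
   With f at every crossing the word determines the underlying 4-valent graph
   together with its embedding in an oriented closed surface; [planar] below
   requires that surface to be the sphere. *)
Definition passage := (nat * bool * option bool)%type.
Definition crossing (p : passage) : nat := p.1.1.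
Definition frame (p : passage) : bool := p.1.2.
Definition role (p : passage) : option bool := p.2.

(* The other passage through the same crossing. *)
Definition mate (p : passage) : passage :=
  (crossing p, ~~ frame p, omap negb (role p)).

(* Every crossing that occurs has exactly two passages, mates of each other. *)
Definition wf_code (s : seq passage) : bool :=
  uniq [seq p.1 | p <- s] && all (fun p => mate p \in s) s.

(* The dart (p, true) leaves the passage p along the orientation of the curve
   and (p, false) leaves it against the orientation.  [face_step] follows a dart
   to the next passage and turns left there, so that its orbits are the
   boundaries of the faces. *)
Definition dart := (passage * bool)%type.

Definition darts (s : seq passage) : seq dart :=
  [seq (p, d) | p <- s, d <- [:: true; false]].

Definition face_step (s : seq passage) (a : dart) : dart :=
  let q := if a.2 then next s a.1 else prev s a.1 in
  (mate q, frame q == a.2).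

Definition face (s : seq passage) (a : dart) : seq dart :=
  [seq b <- darts s | b \in traject (face_step s) a (size (darts s))].

Definition nb_faces (s : seq passage) : nat :=
  size (undup [seq face s a | a <- darts s]).

(* Euler's formula V + F = E + 2, where V = (size s)./2 and E = size s; the
   empty word is the circle without crossings. *)
Definition planar (s : seq passage) : bool :=
  nilp s || ((size s)./2 + nb_faces s == size s + 2)%N.

Definition diagram : Type := {s : seq passage | wf_code s && planar s}.

Definition relabel (h : nat -> nat) (s : seq passage) : seq passage :=
  [seq (h (crossing p), frame p, role p) | p <- s].

(* The two passages met on the side of a triangle of the third moves that goes
   from the corner of b to the corner of a when the boundary of the triangle is
   followed anticlockwise; o tells whether the curve runs along this side in that
   same direction. *)
Definition side (o : bool) (b a : passage) : seq passage :=
  if o then [:: b; a] else [:: a; b].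

(* The roles, at the three corners of a triangle, of the strand i with respect
   to the strand i + 1 (mod 3).
   - Omega_3: all real, and the three strands are top, middle and bottom, i.e.
     over/under is not cyclic;
   - Omega_3': all virtual;
   - Omega_3^s: one real crossing, and a strand with two virtual ones. *)
Definition third_move_roles (r1 r2 r3 : option bool) : bool :=
  let rs := [:: r1; r2; r3] in
  let k := count isSome rs in
  [|| (k == 3) && ~~ constant rs, k == 0 | k == 1]%N.

(* Generalized Reidemeister moves.  Since words are taken up to rotation
   ([move_rot]), the moves are written with a convenient starting point.  The
   names of the crossings being irrelevant, so is [move_relabel].

   The first and second moves are the real ones if role p is a Some and the
   virtual ones if role p = None.  In the second move one strand goes through p
   then q and so crosses the other strand in one direction and then in the
   other; hence frame q = ~~ frame p.

   In the third moves the strands 1, 2, 3 are the sides of a triangular face in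
   anticlockwise order, x_i is the crossing of the strands i and i + 1 (mod 3),
   a_i the passage of strand i through x_i, and mate a_i that of strand i + 1.
   The value of frame a_i says that the triangle lies in the sector to the left
   of its boundary at x_i.  The move reverses the order of the two passages on
   each side.  The curve meets the three sides in the cyclic order 1, 2, 3 or
   1, 3, 2. *)
Inductive move : seq passage -> seq passage -> Prop :=
| move_rot k s : move s (rot k s)
| move_relabel h s : injective h -> move s (relabel h s)
| move_1 p s : move s ([:: p; mate p] ++ s)
| move_2 p q (parallel : bool) s1 s2 :
    frame q = ~~ frame p -> role q = role p ->
    move (s1 ++ s2)
      ([:: p; q] ++ s1 ++
       (if parallel then [:: mate p; mate q] else [:: mate q; mate p]) ++ s2)
| move_3 x1 x2 x3 r1 r2 r3 (o1 o2 o3 cyc : bool) s1 s2 s3 :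
    third_move_roles r1 r2 r3 ->
    let a1 : passage := (x1, o1 == o2, r1) in
    let a2 : passage := (x2, o2 == o3, r2) in
    let a3 : passage := (x3, o3 == o1, r3) in
    let e1 := side o1 (mate a3) a1 in
    let e2 := side o2 (mate a1) a2 in
    let e3 := side o3 (mate a2) a3 in
    let e := if cyc then e2 else e3 in
    let e' := if cyc then e3 else e2 in
    move (e1 ++ s1 ++ e ++ s2 ++ e' ++ s3)
         (rev e1 ++ s1 ++ rev e ++ s2 ++ rev e' ++ s3).

(* Both ends of a move are diagrams; in particular they are planar. *)
Definition diagram_move (D D' : diagram) : Prop := move (val D) (val D').

Definition diagram_equiv (D D' : diagram) : bool :=
  `[< clos_refl_sym_trans diagram diagram_move D D' >].

Lemma diagram_equiv_refl : reflexive diagram_equiv.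
Proof. by move=> D; apply/asboolP; apply: rst_refl. Qed.

Lemma diagram_equiv_sym : symmetric diagram_equiv.
Proof. by move=> D D'; apply/asboolP/asboolP; apply: rst_sym. Qed.

Lemma diagram_equiv_trans : transitive diagram_equiv.
Proof.
by move=> D2 D1 D3 /asboolP h /asboolP h'; apply/asboolP; apply: rst_trans h h'.
Qed.

Canonical diagram_equiv_rel :=
  EquivRel diagram_equiv diagram_equiv_refl diagram_equiv_sym
    diagram_equiv_trans.

Definition virtual_knot : Type := {eq_quot diagram_equiv}%qT.

(* The virtual knot with diagram D. *)
Definition knot_of (D : diagram) : virtual_knot :=
  (\pi_({eq_quot diagram_equiv}) D)%qT.

(* A chord is its name with its sign (true for +1), an endpoint is a chord with
   a boolean: true for c^+ (over), false for c^- (under).  A Gauss diagram is the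
   cyclic word of the endpoints, listed along the orientation of the circle. *)
Definition chord := (nat * bool)%type.
Definition endpoint := (chord * bool)%type.
Definition over (c : chord) : endpoint := (c, true).
Definition under (c : chord) : endpoint := (c, false).

(* The writhe is +1 iff the overcrossing tangent, followed by the undercrossing
   one, is a positively oriented frame. *)
Definition gauss (s : seq passage) : seq endpoint :=
  pmap (fun p => omap (fun o => ((crossing p, frame p == o), o)) (role p)) s.

Definition relabel_gauss (h : nat -> nat) (G : seq endpoint) : seq endpoint :=
  [seq ((h e.1.1, e.1.2), e.2) | e <- G].

Definition chords (G : seq endpoint) : seq chord := [seq e.1 | e <- G & e.2].

Definition writhe (c : chord) : int := if c.2 then 1 else -1.

(* The parity of the number of endpoints met after c^+ and before c^-. *)
Definition odd_chord (G : seq endpoint) (c : chord) : bool :=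
  odd (index (under c) (rot (index (over c) G).+1 G)).

(* The integer N(a) for the arc a immediately before the endpoint of position
   k, which is also the arc immediately after that of position k - 1. *)
Definition arc_N (G : seq endpoint) (k : nat) : int :=
  \sum_(c <- chords G |
        (index (over c) (rot k G) < index (under c) (rot k G))%N) writhe c.

Definition chord_N (G : seq endpoint) (c : chord) : int :=
  let i := index (over c) G in
  let j := index (under c) G in
  if c.2 then arc_N G j.+1 - arc_N G i.+1 else arc_N G j - arc_N G i.

(* Laurent polynomials in t are taken in the field of fractions of Z[t], which
   contains Z[t, t^-1]; exponents are in int. *)
Definition laurent : Type := {fraction {poly int}}.
Definition tvar : laurent := tofrac 'X.

Definition gauss_odd_writhe_poly (G : seq endpoint) : laurent :=
  \sum_(c <- chords G | odd_chord G c) (writhe c)%:~R * tvar ^ chord_N G c.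

(* Evaluated on the chosen representative of the class K; that any other diagram
   of K gives the same value is the invariance of the polynomial. *)
Definition odd_writhe_poly (K : virtual_knot) : laurent :=
  gauss_odd_writhe_poly (gauss (val (repr K))).

(* The Gauss diagram G is obtained by cutting the circles of Ga and Gb inside
   arbitrary arcs and gluing the resulting intervals.  The renamings keep the
   chords of Ga and those of Gb apart: this is automatic when G is the Gauss
   diagram of a diagram. *)
Definition gauss_connected_sum (Ga Gb G : seq endpoint) : Prop :=
  exists (i j : nat) (ha hb : nat -> nat),
    [/\ injective ha, injective hb
      & G = relabel_gauss ha (rot i Ga) ++ relabel_gauss hb (rot j Gb)].

(* K is one of the virtual knots denoted by Ka # Kb. *)
Definition connected_sum (Ka Kb K : virtual_knot) : Prop :=
  exists Da Db D : diagram,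
    [/\ knot_of Da = Ka, knot_of Db = Kb, knot_of D = K
      & gauss_connected_sum (gauss (val Da)) (gauss (val Db)) (gauss (val D))].

(* Main.v *)
From mathcomp Require Import all_boot all_order all_algebra.
From mathcomp Require Import generic_quotient fraction boolp zify ring.
From Stdlib Require Import Relation_Operators.
Require Import Defs.

(** Give each endpoint of a Gauss diagram the weight by which N changes when a
point of the circle moves past it: -w(c) at c^+ and w(c) at c^-. Let S(c) be
the total weight of the endpoints met strictly between c^+ and c^-. Since N is
the primitive of these weights, N(c) = S(c) + 1 whatever the sign of c: for
w(c) = 1 the arcs chosen to define N(c) add the weight w(c) = 1 of c^-, and for
w(c) = -1 they add the weight -w(c) = 1 of c^+. Since each weight is 1 or -1,
the chord c is odd iff S(c) is odd. Hence the polynomial is the sum of w(c)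
t^(S(c) + 1) over the chords with S(c) odd ([gauss_polyE]).

The two endpoints of a chord have opposite weights, so a whole Gauss diagram
has weight zero. In a connected sum, the arc from c^+ to c^- of a chord of one
factor therefore keeps its weight: it contains either all the endpoints of the
other factor or none of them. Chords keep their S(c) and the polynomials add up
([gauss_poly_connected_sum]).

It remains to compute the polynomial of a virtual knot from an arbitrary
diagram ([odd_writhe_poly_knot]), that is, to prove its invariance under the
generalized Reidemeister moves. This is done on the words of passages, where
the weight of an endpoint depends on the frame bit only and a virtual passage
has weight zero ([gauss_poly_passage]). A first move adds a chord with S = 0,
which is even. The two chords of a second move have opposite signs, hence
adjacent endpoints of total weight zero and equal S: their terms cancel. A
third move exchanges the two passages on each side of a triangle, and at each
real corner the resulting changes of S cancel out ([passage_poly_move3]). *)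

Set Implicit Arguments.
Unset Strict Implicit.
Unset Printing Implicit Defensive.

Import GRing.Theory.
Local Open Scope ring_scope.

(** * Weights of initial segments of a word *)

Section Height.

Variables (T : eqType) (d : T -> int).

Definition weight (s : seq T) : int := \sum_(y <- s) d y.

Lemma weight_nil : weight [::] = 0. Proof. exact: big_nil. Qed.

Lemma weight_cons y s : weight (y :: s) = d y + weight s.
Proof. exact: big_cons. Qed.

Lemma weight_cat s1 s2 : weight (s1 ++ s2) = weight s1 + weight s2.
Proof. exact: big_cat. Qed.

(** When x does not occur in s this is the weight of the whole of s, which
makes [height_cat] true without assuming that x occurs. *)
Definition height (s : seq T) (x : T) : int := weight (take (index x s) s).

Lemma height_cons y s x :
  height (y :: s) x = if y == x then 0 else d y + height s x.
Proof.
by rewrite /height /=; case: eqP => _; rewrite ?weight_nil ?weight_cons.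
Qed.

Lemma height_cat s1 s2 x :
  height (s1 ++ s2) x =
  if x \in s1 then height s1 x else weight s1 + height s2 x.
Proof.
elim: s1 => [|y s1 IH] /=; first by rewrite weight_nil add0r.
rewrite !height_cons in_cons eq_sym IH weight_cons; case: eqP => //= _.
by case: ifP => _ //; rewrite addrA.
Qed.

Lemma height_filter (P : pred T) s x :
  (forall y, ~~ P y -> d y = 0) -> P x -> height (filter P s) x = height s x.
Proof.
move=> d0 Px; elim: s => [//|y s IH] /=; rewrite height_cons -IH.
case: ifPn => [_|Py]; first by rewrite height_cons.
by rewrite d0 // add0r; case: eqP Py => // ->; rewrite Px.
Qed.

Lemma height_rot s k x :
  uniq s -> weight s = 0 -> x \in s ->
  height (rot k s) x = height s x - weight (take k s).
Proof.
rewrite /rot; move: (take k s) (drop k s) (cat_take_drop k s) => u v <-.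
rewrite cat_uniq weight_cat mem_cat !height_cat => /and3P[_ /hasPn dis _] uv0.
case: (boolP (x \in v)) => [/dis /negbTE -> _|_ /orP[->|//]]; lia.
Qed.

Lemma height_swap u x y v z :
  uniq (u ++ [:: x; y] ++ v) ->
  height (u ++ [:: y; x] ++ v) z =
  height (u ++ [:: x; y] ++ v) z + (z == x)%:R * d y - (z == y)%:R * d x.
Proof.
elim: u => [|t u IH] /=.
  rewrite !height_cons in_cons negb_or => /and3P[/andP[xy _] _ _].
  rewrite ![z == _]eq_sym; case: (eqVneq x z) xy => [->|_];
    by case: (eqVneq y z) => //= _ _; ring.
rewrite !height_cons => /andP[tu /IH ->].
case: eqP tu => [->|_ _]; last by ring.
rewrite mem_cat !in_cons !negb_or => /and4P[_ /negbTE -> /negbTE -> _].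
by rewrite !mul0r; ring.
Qed.

End Height.

Lemma height_map (T U : eqType) (d : T -> int) (d' : U -> int) (f : T -> U)
    (s : seq T) x :
  {in s, forall y, d' (f y) = d y} -> {in x :: s &, injective f} ->
  height d' (map f s) (f x) = height d s x.
Proof.
elim: s => [|y s IH] df f_inj /=; first by rewrite /height /= !weight_nil.
rewrite !height_cons.
rewrite (inj_in_eq f_inj) ?in_cons ?eqxx ?orbT //; case: ifP => _ //.
rewrite df ?mem_head // IH // => [z zs|z t zs ts].
  by apply: df; rewrite in_cons zs orbT.
by apply: f_inj; rewrite !in_cons in zs ts *;
  [case/orP: zs => -> | case/orP: ts => ->]; rewrite ?orbT.
Qed.

(** * Weight of the arc from a letter to its mate in a cyclic word *)

Section ArcWeight.

Variables (T : eqType) (d : T -> int) (m : T -> T).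

Definition balanced (s : seq T) : bool := uniq s && all (fun x => m x \in s) s.

(** When m x occurs before x this difference is minus the weight of the arc
from m x to x; in a word of weight zero that is also the weight of the arc
which goes from x to m x through the end of the word. *)
Definition arc_weight (s : seq T) (x : T) : int :=
  height d s (m x) - height d s x - d x.

Lemma balanced_uniq s : balanced s -> uniq s. Proof. by case/andP. Qed.

Lemma balanced_mem s x : balanced s -> x \in s -> m x \in s.
Proof. by case/andP=> _ /allP; apply. Qed.

Lemma balanced_rot k s : balanced (rot k s) = balanced s.
Proof.
rewrite /balanced rot_uniq (eq_all_r (mem_rot k s)); congr (_ && _).
by apply: eq_all => x; rewrite /= mem_rot.
Qed.

Hypotheses (mK : involutive m) (dm : forall x, d (m x) = - d x).

Lemma weight_balanced s : balanced s -> weight d s = 0.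
Proof.
move=> bs; have us := balanced_uniq bs.
have /(perm_big _) sm : perm_eq s (map m s).
  apply: uniq_perm; rewrite ?(map_inj_uniq (inv_inj mK)) // => x.
  apply/idP/mapP => [xs|[y ys ->]]; last exact: balanced_mem.
  by exists (m x); rewrite ?mK ?balanced_mem.
have: weight d s = - weight d s.
  by rewrite /weight {1}sm big_map -sumrN; apply: eq_bigr => x _; rewrite dm.
by lia.
Qed.

Lemma arc_weight_rot k s x : balanced s -> x \in s ->
  arc_weight (rot k s) x = arc_weight s x.
Proof.
move=> bs xs; have us := balanced_uniq bs; have s0 := weight_balanced bs.
by rewrite /arc_weight !height_rot ?(balanced_mem bs) //; ring.
Qed.

(** Reading the cyclic word from just after x puts the arc from x to m x at the
front, which identifies [arc_weight] with the weight of this arc. *)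
Lemma arc_weight_after s x : balanced s -> x \in s ->
  height d (rot (index x s).+1 s) (m x) = arc_weight s x.
Proof.
move=> bs xs.
have us := balanced_uniq bs; have s0 := weight_balanced bs.
rewrite height_rot ?(balanced_mem bs) // (take_nth x) ?index_mem //.
rewrite nth_index // -cats1 weight_cat weight_cons weight_nil.
by rewrite /arc_weight /height; ring.
Qed.

Lemma arc_weight_catl s1 s2 x :
  x \in s1 -> m x \in s1 -> arc_weight (s1 ++ s2) x = arc_weight s1 x.
Proof. by move=> x1 mx1; rewrite /arc_weight !height_cat x1 mx1. Qed.

Lemma arc_weight_catr s1 s2 x :
  x \notin s1 -> m x \notin s1 -> arc_weight (s1 ++ s2) x = arc_weight s2 x.
Proof.
by move=> /negbTE x1 /negbTE mx1; rewrite /arc_weight !height_cat x1 mx1; ring.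
Qed.

Lemma arc_weight_filter (P : pred T) s x :
  (forall y, ~~ P y -> d y = 0) -> P x -> P (m x) ->
  arc_weight (filter P s) x = arc_weight s x.
Proof. by move=> d0 Px Pmx; rewrite /arc_weight !height_filter. Qed.

End ArcWeight.

Lemma arc_weight_map (T U : eqType) (d : T -> int) (d' : U -> int) (m : T -> T)
    (m' : U -> U) (f : T -> U) (s : seq T) x :
  {in s, forall y, d' (f y) = d y} -> {in s &, injective f} ->
  m' (f x) = f (m x) -> x \in s -> m x \in s ->
  arc_weight d' m' (map f s) (f x) = arc_weight d m s x.
Proof.
move=> df f_inj fm xs mxs.
have sub y : y \in s -> y :: s =i s.
  by move=> ys z; rewrite in_cons; case: eqP => // ->.
have inj y : y \in s -> {in y :: s &, injective f}.
  by move=> ys z t; rewrite !sub //; apply: f_inj.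
by rewrite /arc_weight fm !(height_map df) ?df //; apply: inj.
Qed.

(** * The polynomial of a Gauss diagram in terms of arc weights *)

Definition opposite (e : endpoint) : endpoint := (e.1, ~~ e.2).

(** The change of N when the starting point moves past e. *)
Definition jump (e : endpoint) : int :=
  if e.2 then - writhe e.1 else writhe e.1.

(** The term of a chord with sign b and arc weight k, whose N is k + 1. *)
Definition contribution (b : bool) (k : int) : laurent :=
  if odd `|k|%N then (if b then 1 else -1) * tvar ^ (k + 1) else 0.

Lemma contributionN b k : contribution (~~ b) k = - contribution b k.
Proof.
rewrite /contribution; case: ifP => _; last by rewrite oppr0.
by case: b; rewrite !mulNr ?opprK.
Qed.

Lemma oppositeK : involutive opposite.
Proof. by case=> c o; rewrite /opposite /= negbK. Qed.

Lemma jump_opposite e : jump (opposite e) = - jump e.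
Proof. by case: e => c []; rewrite /jump /= ?opprK. Qed.

Notation chord_weight G c := (arc_weight jump opposite G (over c)).

Lemma over_chords G c : (c \in chords G) = (over c \in G).
Proof.
apply/mapP/idP => [[[c' o]]|cG].
  by rewrite mem_filter /= => /andP[o_ cG] ->; move: o_ cG => /= ->.
by exists (over c); rewrite ?mem_filter.
Qed.

Lemma chords_uniq G : uniq G -> uniq (chords G).
Proof.
move=> uG; rewrite /chords map_inj_in_uniq ?filter_uniq //.
move=> [c o] [c' o']; rewrite !mem_filter /=.
by do 2!case/andP=> -> _; move=> ->.
Qed.

Lemma sum_over_under (G : seq endpoint) (F : endpoint -> int) :
  balanced opposite G ->
  \sum_(e <- G) F e = \sum_(c <- chords G) (F (over c) + F (under c)).
Proof.
move=> bG; have uG := balanced_uniq bG.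
have /(perm_big _) -> : perm_eq G (map over (chords G) ++ map under (chords G)).
  apply: uniq_perm => //.
    have [over_inj under_inj] : injective over /\ injective under.
      by split=> ? ? [].
    rewrite cat_uniq (map_inj_uniq over_inj) (map_inj_uniq under_inj).
    rewrite chords_uniq // andbT /=.
    by apply/hasPn => _ /mapP[c _ ->]; apply/mapP => -[].
  move=> [c o]; rewrite mem_cat; apply/idP/orP => [cG|[]/mapP[c' + [-> ->]]].
  - case: o cG => cG; [left|right]; apply: map_f; rewrite over_chords //.
    exact: (balanced_mem bG cG).
  - by rewrite over_chords.
  - by rewrite over_chords => /(balanced_mem bG).
by rewrite big_cat !big_map big_split.
Qed.

Lemma index_rot_uniq (T : eqType) (s : seq T) k x :
  uniq s -> x \in s -> (k <= size s)%N ->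
  index x (rot k s) = if (index x s < k)%N then (index x s + (size s - k))%N
                      else (index x s - k)%N.
Proof.
move=> us xs ks; rewrite -(in_take k xs) -(size_drop k s) /rot.
move: us xs (size_takel ks); rewrite -{1 2 7 9}(cat_take_drop k s).
move: (take k s) (drop k s) => u v.
rewrite cat_uniq mem_cat !index_cat => /and3P[_ /hasPn dis _] xuv uk.
case: (boolP (x \in v)) xuv => [/dis /negbTE -> _|_ /orP[->|//]].
  by rewrite -uk addKn.
by rewrite addnC.
Qed.

(** N is a primitive of the weights. Moving the starting point past the first k
endpoints affects the chord c only if this passes exactly one of c^+ and c^-,
and then changes its term by the weight of that endpoint. *)
Lemma arc_NE G k : balanced opposite G -> (k <= size G)%N ->
  arc_N G k = arc_N G 0 + weight jump (take k G).
Proof.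
move=> bG kG; have uG := balanced_uniq bG.
have -> : weight jump (take k G) =
          \sum_(e <- G) (if (index e G < k)%N then jump e else 0).
  have [/hasPn dis tk] : ~~ has [in take k G] (drop k G) /\
      (forall e, e \in G -> (e \in take k G) = (index e G < k)%N).
    split=> [|e]; last exact: in_take.
    by have := uG; rewrite -{1}(cat_take_drop k G) cat_uniq => /and3P[].
  rewrite /weight -{2}(cat_take_drop k G) big_cat /= -[LHS]addr0.
  congr (_ + _).
    by apply: eq_big_seq => e ek; rewrite -tk ?ek // (mem_take ek).
  apply/esym; rewrite big_seq big1 // => e ek.
  by rewrite -tk ?(mem_drop ek) // (negbTE (dis _ ek)).
rewrite sum_over_under // /arc_N [LHS]big_mkcond [X in _ = X + _]big_mkcond.
apply: (etrans _ (big_split _ _ _ _ _)) => /=; apply: eq_big_seq => c.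
rewrite over_chords => oc.
have uc : under c \in G by exact: (balanced_mem bG oc).
have ij : index (over c) G <> index (under c) G.
  by move=> /(index_inj (over c) oc uc).
have := oc; have := uc; rewrite -!index_mem.
rewrite rot0 !index_rot_uniq // /jump /=.
(* What is left is a statement on the positions i and j of c^+ and c^-. *)
move: (index (over c) G) (index (under c) G) ij => i j ij ??.
case: (ltnP i k) => ?; case: (ltnP j k) => ?; do 2![case: ltnP => ?]; lia.
Qed.

Lemma odd_weight_jump G : odd `|weight jump G|%N = odd (size G).
Proof.
elim: G => [|[[x b] o] G IH]; first by rewrite weight_nil.
by rewrite weight_cons /= -IH /jump /writhe; case: b; case: o => /=; lia.
Qed.

(** The arc from c^+ to c^- has as many endpoints as its weight, modulo 2,
because every weight is odd. *)
Lemma odd_chordE G c : balanced opposite G -> over c \in G ->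
  odd_chord G c = odd `|chord_weight G c|%N.
Proof.
move=> bG oc.
rewrite -arc_weight_after //; [|exact: oppositeK|exact: jump_opposite].
by rewrite odd_weight_jump size_takel // index_size.
Qed.

(** The arcs in the definition of N(c) lie after c^+ and c^- or before them
according to the sign; either way the difference exceeds the weight of the open
arc from c^+ to c^- by the weight of one end of c, which is 1. *)
Lemma chord_NE G c : balanced opposite G -> over c \in G ->
  chord_N G c = chord_weight G c + 1.
Proof.
move=> bG oc; have uc : under c \in G by exact: (balanced_mem bG oc).
have := oc; have := uc; rewrite -!index_mem => ltj lti.
move: (arc_N G 0) (fun k => @arc_NE G k bG) => a arcE.
rewrite /chord_N (arcE _ lti) (arcE _ ltj).
rewrite (arcE _ (ltnW lti)) (arcE _ (ltnW ltj)) /arc_weight /height /=.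
rewrite !(take_nth (over c)) // !nth_index // -!cats1.
rewrite !weight_cat !weight_cons !weight_nil.
by rewrite /opposite /jump /writhe /=; case: c.2 => /=; ring.
Qed.

Lemma gauss_polyE G : balanced opposite G ->
  gauss_odd_writhe_poly G =
  \sum_(c <- chords G) contribution c.2 (chord_weight G c).
Proof.
move=> bG; rewrite /gauss_odd_writhe_poly big_mkcond; apply: eq_big_seq => c.
rewrite over_chords => oc; rewrite odd_chordE // chord_NE //.
rewrite /contribution /writhe.
by case: c.2; rewrite /= ?rmorphN ?rmorph1.
Qed.

(** * Connected sums *)

Lemma gauss_poly_rot k G : balanced opposite G ->
  gauss_odd_writhe_poly (rot k G) = gauss_odd_writhe_poly G.
Proof.
move=> bG; rewrite !gauss_polyE ?balanced_rot //.
have /(perm_big _) -> : perm_eq (chords (rot k G)) (chords G).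
  by apply/perm_map/perm_filter; rewrite perm_rot.
apply: eq_big_seq => c; rewrite over_chords => oc.
by rewrite arc_weight_rot //; [exact: oppositeK | exact: jump_opposite].
Qed.

Lemma relabel_gauss_inj h : injective h ->
  injective (fun e : endpoint => ((h e.1.1, e.1.2), e.2) : endpoint).
Proof. by move=> h_inj [[x b] o] [[y b'] o'] /= [/h_inj -> -> ->]. Qed.

Lemma balanced_relabel_gauss h G : injective h -> balanced opposite G ->
  balanced opposite (relabel_gauss h G).
Proof.
move=> /relabel_gauss_inj h_inj bG; apply/andP; split.
  by rewrite map_inj_uniq ?(balanced_uniq bG).
apply/allP => _ /mapP[e /(balanced_mem bG) eG ->].
by apply/mapP; exists (opposite e).
Qed.

Lemma gauss_poly_relabel h G : injective h -> balanced opposite G ->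
  gauss_odd_writhe_poly (relabel_gauss h G) = gauss_odd_writhe_poly G.
Proof.
move=> h_inj bG; rewrite !gauss_polyE ?balanced_relabel_gauss //.
have -> : chords (relabel_gauss h G) = [seq (h c.1, c.2) | c <- chords G].
  by rewrite /chords /relabel_gauss filter_map -!map_comp.
rewrite big_map; apply: eq_big_seq => c; rewrite over_chords => oc /=.
congr contribution.
apply: (@arc_weight_map _ _ _ _ opposite _ _ G (over c)) => //.
  by move=> ? ? _ _; apply: relabel_gauss_inj.
exact: (balanced_mem bG oc).
Qed.

(** Concatenation leaves the arc weights of the chords of G1 alone, and shifts
by the weight of G1 the heights of both ends of a chord of G2. That the whole
word is balanced ensures that no endpoint occurs in both factors. *)
Lemma gauss_poly_cat G1 G2 :
  balanced opposite G1 -> balanced opposite G2 ->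
  balanced opposite (G1 ++ G2) ->
  gauss_odd_writhe_poly (G1 ++ G2) =
  gauss_odd_writhe_poly G1 + gauss_odd_writhe_poly G2.
Proof.
move=> b1 b2 b12; rewrite !gauss_polyE //.
have -> : chords (G1 ++ G2) = chords G1 ++ chords G2.
  by rewrite /chords filter_cat map_cat.
have := balanced_uniq b12; rewrite cat_uniq => /and3P[_ /hasPn dis _].
rewrite big_cat /=; congr (_ + _);
  apply: eq_big_seq => c; rewrite over_chords => oc.
  by rewrite arc_weight_catl // (balanced_mem b1).
by rewrite arc_weight_catr // dis // (balanced_mem b2).
Qed.

Lemma gauss_poly_connected_sum Ga Gb G :
  balanced opposite Ga -> balanced opposite Gb -> balanced opposite G ->
  gauss_connected_sum Ga Gb G ->
  gauss_odd_writhe_poly G = gauss_odd_writhe_poly Ga + gauss_odd_writhe_poly Gb.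
Proof.
move=> ba bb bG [i [j [ha [hb [ha_inj hb_inj defG]]]]]; subst G.
by rewrite gauss_poly_cat ?gauss_poly_relabel ?gauss_poly_rot
  ?balanced_relabel_gauss ?balanced_rot.
Qed.

(** * The polynomial read on the passages of a diagram *)

Definition is_real (p : passage) : bool := isSome (role p).

(** The [jump] of the endpoint of p: the sign of the crossing is the comparison
of the frame with the role, so only the frame is left. *)
Definition turn (p : passage) : int :=
  if is_real p then (if frame p then -1 else 1) else 0.

Notation passage_weight := (arc_weight turn mate).

(** The endpoint of a real passage; the default role is used for virtual
passages, which do not occur in the Gauss diagram. *)
Definition endpoint_of (p : passage) : endpoint :=
  ((crossing p, frame p == odflt true (role p)), odflt true (role p)).

Lemma mateK : involutive mate.
Proof. by move=> [[x f] [[]|]]; rewrite /mate /= negbK. Qed.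

Lemma turn_mate p : turn (mate p) = - turn p.
Proof. by case: p => [[x []] [[]|]]. Qed.

Lemma is_real_mate p : is_real (mate p) = is_real p.
Proof. by case: p => [[x f] []]. Qed.

Lemma role_mate p : role (mate p) = omap negb (role p). Proof. by []. Qed.

Lemma frame_mate p : frame (mate p) = ~~ frame p. Proof. by []. Qed.

Lemma wf_balanced s : wf_code s -> balanced mate s.
Proof. by case/andP=> /map_uniq us ms; apply/andP. Qed.

Lemma endpoint_of_inj : {in is_real &, injective endpoint_of}.
Proof.
by move=> [[x []] [[]|]] [[y []] [[]|]] // _ _ []; rewrite /crossing /= => ->.
Qed.

Lemma gaussE s : gauss s = [seq endpoint_of p | p <- s & is_real p].
Proof.
elim: s => [//|[[x f] [o|]] s IH] //=.
by rewrite /gauss /= -/(gauss s) IH.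
Qed.

Lemma balanced_gauss s : balanced mate s -> balanced opposite (gauss s).
Proof.
move=> bs; rewrite gaussE; apply/andP; split.
  rewrite map_inj_in_uniq ?filter_uniq ?(balanced_uniq bs) // => p q.
  by rewrite !mem_filter => /andP[rp _] /andP[rq _]; apply: endpoint_of_inj.
apply/allP => _ /mapP[p + ->]; rewrite mem_filter => /andP[rp ps].
apply/mapP; exists (mate p).
  by rewrite mem_filter is_real_mate rp (balanced_mem bs).
by case: p rp {ps} => [[x []] [[]|]].
Qed.

(** The sign of a crossing is the frame bit of its over passage. *)
Definition passage_poly (s : seq passage) : laurent :=
  \sum_(p <- s | role p == Some true)
    contribution (frame p) (passage_weight s p).

(** Virtual passages have weight zero, so erasing them does not change the
weight of an arc. *)
Lemma gauss_poly_passage s : balanced mate s ->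
  gauss_odd_writhe_poly (gauss s) = passage_poly s.
Proof.
move=> bs; rewrite gauss_polyE ?balanced_gauss //.
have -> : chords (gauss s) =
    [seq (crossing p, frame p) | p <- s & role p == Some true].
  elim: s {bs} => [//|[[x f] [[]|]] s IH] //=; rewrite /chords /gauss /= ?IH //.
  by rewrite -/(gauss s) -/(chords _) IH eqb_id.
rewrite big_map big_filter /passage_poly big_seq_cond [RHS]big_seq_cond.
apply: eq_bigr => p /andP[ps /eqP rp] /=; congr contribution.
have realp : is_real p by rewrite /is_real rp.
rewrite -(@arc_weight_filter _ turn mate is_real) ?is_real_mate //; last first.
  by move=> q /negbTE; rewrite /turn => ->.
have -> : over (crossing p, frame p) = endpoint_of p.
  by rewrite /endpoint_of rp /= eqb_id.
rewrite gaussE; apply: arc_weight_map.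
- move=> [[x f] r]; rewrite mem_filter => /andP[+ _].
  by case: r f => [[]|] // [].
- move=> q q'; rewrite !mem_filter => /andP[rq _] /andP[rq' _].
  exact: endpoint_of_inj.
- by case: p rp {ps realp} => [[x []] r] /= ->.
- by rewrite mem_filter realp.
- by rewrite mem_filter is_real_mate realp (balanced_mem bs).
Qed.

(** * Invariance under the moves *)

Lemma passage_poly_perm s s' : perm_eq s' s ->
  (forall p, p \in s -> is_real p ->
     passage_weight s' p = passage_weight s p) ->
  passage_poly s' = passage_poly s.
Proof.
move=> ss' sp; rewrite /passage_poly (perm_big _ ss') big_seq_cond.
rewrite [RHS]big_seq_cond; apply: eq_bigr => p /andP[ps /eqP rp].
by rewrite sp // /is_real rp.
Qed.

Lemma passage_poly_relabel h s : injective h -> balanced mate s ->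
  passage_poly (relabel h s) = passage_poly s.
Proof.
move=> h_inj bs; rewrite /passage_poly big_map /= big_seq_cond.
rewrite [RHS]big_seq_cond; apply: eq_bigr => p /andP[ps _].
congr contribution; apply: arc_weight_map => //; last exact: (balanced_mem bs).
move=> [[x f] r] [[y f'] r'] _ _ [/h_inj].
by rewrite /crossing /frame /role /= => -> -> ->.
Qed.

(** Nothing lies between p and mate p and the rest of the word has weight zero,
so the new chord is even whichever passage is over. The word [:: p; mate p] has
weight zero, so the other arcs keep their weights. *)
Lemma passage_poly_move1 p s :
  balanced mate s -> balanced mate ([:: p; mate p] ++ s) ->
  passage_poly ([:: p; mate p] ++ s) = passage_poly s.
Proof.
move=> bs bps; have := balanced_uniq bps; rewrite cat_uniq.
move=> /and3P[up /hasPn dis _].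
rewrite /passage_poly big_cat -[RHS]add0r; congr (_ + _); last first.
  rewrite big_seq_cond [RHS]big_seq_cond; apply: eq_bigr => q /andP[qs _].
  by rewrite arc_weight_catr // dis // (balanced_mem bs).
have pm : (p == mate p) = false.
  by case: p {bs bps dis up} => [[x []] r]; apply/eqP.
rewrite big1_seq // => q /andP[_].
rewrite !inE /contribution /arc_weight => /orP[]/eqP->.
  by rewrite !height_cons !eqxx pm addr0 subr0 subrr.
by rewrite mateK !height_cons !eqxx pm turn_mate addr0 sub0r subrr.
Qed.

(** The weights of p and q cancel, as do those of their mates, so no other arc
changes weight. The arcs of the two new crossings start next to each other and
end next to each other; they have equal weight, and the crossings have opposite
signs. *)
Lemma passage_poly_move2 p q (parallel : bool) s1 s2 :
  frame q = ~~ frame p -> role q = role p ->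
  let s' := [:: p; q] ++ s1 ++
    (if parallel then [:: mate p; mate q] else [:: mate q; mate p]) ++ s2 in
  balanced mate (s1 ++ s2) -> balanced mate s' ->
  passage_poly s' = passage_poly (s1 ++ s2).
Proof.
move=> fq rq s' bs bs'; set blk := if parallel then _ else _ in s' bs' *.
have turnq : turn q = - turn p.
  by rewrite /turn /is_real fq rq; case: (role p) (frame p) => [[]|] [].
have wblk : weight turn blk = 0.
  rewrite /blk; case: (parallel);
    by rewrite !weight_cons weight_nil !turn_mate turnq; ring.
have wpq : weight turn [:: p; q] = 0.
  by rewrite !weight_cons weight_nil turnq; ring.
have perm_s' : perm_eq s' (([:: p; q] ++ blk) ++ s1 ++ s2).
  by rewrite /s' -catA perm_cat2l perm_catCA.
have us := balanced_uniq bs'; have := us; rewrite (perm_uniq perm_s').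
rewrite cat_uniq => /and3P[ublk /hasPn dis _].
rewrite /passage_poly (perm_big _ perm_s') big_cat /= -[RHS]add0r.
have old z : z \in s1 ++ s2 -> height turn s' z = height turn (s1 ++ s2) z.
  move=> /dis; rewrite mem_cat negb_or => /andP[/negbTE zpq /negbTE zb].
  by rewrite /s' !height_cat zpq zb wblk wpq !add0r.
congr (_ + _); last first.
  rewrite big_seq_cond [RHS]big_seq_cond; apply: eq_bigr => z /andP[zs _].
  by rewrite /arc_weight !old // (balanced_mem bs).
have pq : (p == q) = false.
  by apply/eqP => pq; move: fq; rewrite -pq; case: frame.
have qp : (q == p) = false by rewrite eq_sym.
have mate_pq := (inj_eq (inv_inj mateK)).
have hp : height turn s' p = 0 by rewrite height_cons eqxx.
have hq : height turn s' q = turn p by rewrite !height_cons eqxx pq addr0.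
have blkE z : z \in blk ->
    height turn s' z = weight turn s1 + height turn blk z.
  move=> zb; have := us; rewrite /s' catA cat_uniq => /and3P[_ /hasPn zout _].
  rewrite height_cat (negbTE (zout z _)) ?mem_cat ?zb //.
  by rewrite weight_cat wpq add0r height_cat zb.
have hmp : height turn s' (mate p) =
           weight turn s1 + (if parallel then 0 else turn p).
  rewrite blkE /blk; case: (parallel); rewrite ?inE ?eqxx ?orbT //.
    by rewrite !height_cons eqxx.
  by rewrite !height_cons mate_pq qp eqxx turn_mate turnq; ring.
have hmq : height turn s' (mate q) =
           weight turn s1 - (if parallel then turn p else 0).
  rewrite blkE /blk; case: (parallel); rewrite ?inE ?eqxx ?orbT //.
    by rewrite !height_cons mate_pq pq eqxx turn_mate; ring.
  by rewrite !height_cons eqxx; ring.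
have eq_pq : passage_weight s' q = passage_weight s' p.
  by rewrite /arc_weight hp hq hmp hmq turnq; case: (parallel); ring.
have eq_mate_pq : passage_weight s' (mate q) = passage_weight s' (mate p).
  rewrite /arc_weight !mateK hp hq hmp hmq !turn_mate turnq.
  by case: (parallel); ring.
have swap_mates : perm_eq [:: p, q & blk] [:: p; q; mate p; mate q].
  rewrite /blk; case: (parallel) => //.
  by rewrite (perm_cat2l [:: p; q]) (perm_catC [:: mate q]).
rewrite (perm_big _ swap_mates) !big_cons big_nil eq_pq eq_mate_pq.
(* At a crossing with virtual roles no term is present; otherwise one of the two
pairs consists of under passages, and the terms of the other pair cancel. *)
rewrite !role_mate !frame_mate fq rq !contributionN.
by case: (role p) => [[]|] /=; rewrite ?addr0 ?opprK ?subrr ?addNr.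
Qed.

(** This is -1 if reversing [side o b a] moves a before b, and 1 if it moves a
after b. *)
Definition orient (o : bool) : int := if o then -1 else 1.

Lemma height_side o a b u v z : uniq (u ++ side o b a ++ v) ->
  height turn (u ++ rev (side o b a) ++ v) z =
  height turn (u ++ side o b a ++ v) z
  + orient o * ((z == a)%:R * turn b - (z == b)%:R * turn a).
Proof. by case: o => us; rewrite [LHS]height_swap // /orient; ring. Qed.

(** Reversing a side changes the height of each of its two passages by plus or
minus the weight of the other one, and nothing else. Write e_i for [orient o_i]
and R_i for 1 or 0 according as the corner x_i is real or virtual, indices
being modulo 3, so that the weight of a_i is - R_i e_i e_(i+1). As e_i^2 = 1,
the arc weight of a_i decreases by e_(i-1) (R_(i-1) - R_(i+1)) and that of its
mate increases by as much. At a real corner, R_(i-1) and R_(i+1) can only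
differ if exactly two corners are real, and this is not a third move. *)
Lemma passage_poly_move3 x1 x2 x3 r1 r2 r3 (o1 o2 o3 cyc : bool) s1 s2 s3 :
  third_move_roles r1 r2 r3 ->
  let a1 : passage := (x1, o1 == o2, r1) in
  let a2 : passage := (x2, o2 == o3, r2) in
  let a3 : passage := (x3, o3 == o1, r3) in
  let e1 := side o1 (mate a3) a1 in
  let e2 := side o2 (mate a1) a2 in
  let e3 := side o3 (mate a2) a3 in
  let e := if cyc then e2 else e3 in
  let e' := if cyc then e3 else e2 in
  let s := e1 ++ s1 ++ e ++ s2 ++ e' ++ s3 in
  let s' := rev e1 ++ s1 ++ rev e ++ s2 ++ rev e' ++ s3 in
  uniq s -> passage_poly s' = passage_poly s.
Proof.
move=> roles a1 a2 a3 e1 e2 e3 e e' s s' us.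
have perm1 : perm_eq (rev e1 ++ s1 ++ e ++ s2 ++ e' ++ s3) s.
  by rewrite perm_cat2r perm_rev.
have perm2 : perm_eq (rev e1 ++ s1 ++ rev e ++ s2 ++ e' ++ s3) s.
  by apply: perm_trans perm1; rewrite !perm_cat2l perm_cat2r perm_rev.
have perm3 : perm_eq s' s.
  by apply: perm_trans perm2; rewrite !perm_cat2l perm_cat2r perm_rev.
have heightE z : height turn s' z = height turn s z +
    (orient o1 * ((z == a1)%:R * turn (mate a3)
                  - (z == mate a3)%:R * turn a1) +
     orient o2 * ((z == a2)%:R * turn (mate a1)
                  - (z == mate a1)%:R * turn a2) +
     orient o3 * ((z == a3)%:R * turn (mate a2)
                  - (z == mate a2)%:R * turn a3)).
  have u1 : uniq ([::] ++ e1 ++ s1 ++ e ++ s2 ++ e' ++ s3) by [].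
  have u2 : uniq ((rev e1 ++ s1) ++ e ++ s2 ++ e' ++ s3).
    by rewrite -catA (perm_uniq perm1).
  have u3 : uniq ((rev e1 ++ s1 ++ rev e ++ s2) ++ e' ++ s3).
    by rewrite -!catA (perm_uniq perm2).
  rewrite /s' /s /e' /e /e1 /e2 /e3 in u1 u2 u3 *; case: (cyc) in u1 u2 u3 *;
    have E1 := height_side z u1; have E2 := height_side z u2;
    have E3 := height_side z u3; rewrite /= -?catA in E1 E2 E3;
    by rewrite E3 E2 E1; ring.
apply: passage_poly_perm perm3 _ => p _ rp.
rewrite /arc_weight !heightE !(inj_eq (inv_inj mateK)) !turn_mate.
have mate_eq a : (mate p == a) = (p == mate a).
  by rewrite -{1}(mateK a) (inj_eq (inv_inj mateK)).
have virtual_at a : role a = None -> (p == a) = false /\ (p == mate a) = false.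
  move=> ra; have va : ~~ is_real a by rewrite /is_real ra.
  by split; apply: contraTF rp => /eqP->; rewrite ?is_real_mate.
have := (virtual_at a1, virtual_at a2, virtual_at a3).
have -> : turn a1 = (isSome r1)%:R * (orient o1 * - orient o2).
  by rewrite /turn /is_real /role /frame /=; case: (r1) (o1) (o2) => [?|] [] [].
have -> : turn a2 = (isSome r2)%:R * (orient o2 * - orient o3).
  by rewrite /turn /is_real /role /frame /=; case: (r2) (o2) (o3) => [?|] [] [].
have -> : turn a3 = (isSome r3)%:R * (orient o3 * - orient o1).
  by rewrite /turn /is_real /role /frame /=; case: (r3) (o3) (o1) => [?|] [] [].
have not2 : (isSome r1 + isSome r2 + isSome r3 != 2)%N.
  by move: roles; case: (r1) (r2) (r3) => [?|] [?|] [?|].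
rewrite !mate_eq /role /=.
move: (p == a1) (p == mate a1) (p == a2) (p == mate a2) => b1 c1 b2 c2.
move: (p == a3) (p == mate a3) => b3 c3 [[h1 h2] h3].
(* If r is real then r' and r'' are both real or both virtual. *)
have vanish (r r' r'' : option bool) (b c : bool) :
    (r = None -> b = false /\ c = false) ->
    (isSome r + isSome r' + isSome r'' != 2)%N ->
    (b%:R - c%:R) * ((isSome r'')%:R - (isSome r')%:R) = 0 :> int.
  case: r => [?|/(_ erefl)[-> ->]]; last by rewrite subrr mul0r.
  by case: r' r'' => [?|] [?|] //=; rewrite subrr mulr0.
have at1 := vanish r1 r2 r3 b1 c1 h1 not2.
have at2 : (b2%:R - c2%:R) * ((isSome r1)%:R - (isSome r3)%:R) = 0 :> int.
  by apply: (vanish r2) => //; rewrite addnC addnA.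
have at3 : (b3%:R - c3%:R) * ((isSome r2)%:R - (isSome r1)%:R) = 0 :> int.
  by apply: (vanish r3) => //; rewrite -addnA addnC.
transitivity (height turn s (mate p) - height turn s p - turn p -
  (orient o3 * ((b1%:R - c1%:R) * ((isSome r3)%:R - (isSome r2)%:R)) +
   orient o1 * ((b2%:R - c2%:R) * ((isSome r1)%:R - (isSome r3)%:R)) +
   orient o2 * ((b3%:R - c3%:R) * ((isSome r2)%:R - (isSome r1)%:R)))).
  by case: (o1) (o2) (o3) => [] [] []; rewrite /orient; ring.
by rewrite at1 at2 at3; ring.
Qed.

Lemma passage_poly_move s s' : move s s' -> wf_code s -> wf_code s' ->
  passage_poly s' = passage_poly s.
Proof.
case=> {s s'} [k s|h s h_inj|p s|p q parallel s1 s2 fq rq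
              |x1 x2 x3 r1 r2 r3 o1 o2 o3 cyc s1 s2 s3 roles];
  move=> /= /wf_balanced bs /wf_balanced bs'.
- apply: passage_poly_perm => [|p ps _]; first by rewrite perm_rot.
  by rewrite arc_weight_rot //; [exact: mateK | exact: turn_mate].
- exact: passage_poly_relabel.
- exact: passage_poly_move1.
- exact: passage_poly_move2.
- exact: passage_poly_move3 (balanced_uniq bs).
Qed.

Lemma gauss_poly_equiv (D D' : diagram) : diagram_equiv D D' ->
  gauss_odd_writhe_poly (gauss (val D)) =
  gauss_odd_writhe_poly (gauss (val D')).
Proof.
have wf (E : diagram) : wf_code (val E) by case: E => s /= /andP[].
move/asboolP; elim=> {D D'} [D D' DD'|//|D D' _ -> //|D D' D'' _ -> _ -> //].
rewrite !gauss_poly_passage ?wf_balanced //; apply/esym.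
exact: passage_poly_move DD' _ _.
Qed.

Lemma odd_writhe_poly_knot D :
  odd_writhe_poly (knot_of D) = gauss_odd_writhe_poly (gauss (val D)).
Proof.
rewrite /odd_writhe_poly; apply: gauss_poly_equiv.
apply/eqquotP.
exact: (reprK (knot_of D)).
Qed.

Theorem proposition4p9 (Ka Kb K : virtual_knot) (hK : connected_sum Ka Kb K) :
  odd_writhe_poly K = odd_writhe_poly Ka + odd_writhe_poly Kb.
Proof.
have bal (D : diagram) : balanced opposite (gauss (val D)).
  by case: D => s /= /andP[/wf_balanced bs _]; apply: balanced_gauss.
case: hK => [Da [Db [D [<- <- <- sum]]]].
by rewrite !odd_writhe_poly_knot; apply: gauss_poly_connected_sum.
Qed.
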